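(* Let $f(x)\in\mathbb{Z}[x]$ be monic and irreducible over $\mathbb{Q}$ with a complex root $\alpha$ such that $\mathbb{Q}(\alpha)/\mathbb{Q}$ is a Galois extension, and let $G=\mathrm{Gal}(\mathbb{Q}(\alpha)/\mathbb{Q})$. Let $\chi$ be an irreducible complex character of $G$ of degree $\chi(1)=1$ (i.e. a homomorphism $G\to\mathbb{C}^\times$), and let $l$ be the order of $\chi$ (so $\mathbb{Q}(\chi)=\mathbb{Q}(\zeta_l)$ with $\zeta_l$ a primitive $l$-th root of unity). Then either $LR(\chi)=\{0\}$, or $\sum_{g\in G}\chi(g)^d g(\alpha)=0$ for every integer $d$ relatively prime to $l$. Moreover, if $LR(\chi)\neq\{0\}$ (equivalently, $\sum_{g\in G}\chi(g)^d g(\alpha)=0$ for every integer $d$ relatively prime to $l$), then $$LR(\chi)=\Big\{\sum_{g\in G}\mathrm{tr}_{\mathbb{Q}(\zeta_l)/\mathbb{Q}}\big(m\,\overline{\chi(g)}\big)\,g \;\Big|\; m\in\mathbb{Q}(\zeta_l)\Big\}$$ and $\dim_{\mathbb{Q}}LR(\chi)=[\mathbb{Q}(\zeta_l):\mathbb{Q}]$.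
   Context: $\mathbb{C}[G]$ and $\mathbb{Q}[G]$ denote group algebras. For an irreducible complex character $\chi$ of $G$: $c_\chi=\chi(1)|G|^{-1}\sum_{g\in G}\overline{\chi(g)}\,g$ is the corresponding central idempotent; $\mathbb{Q}(\chi)=\mathbb{Q}(\{\chi(g):g\in G\})$ and $\mathrm{Gal}(\chi)=\mathrm{Gal}(\mathbb{Q}(\chi)/\mathbb{Q})$; for $\tau\in\mathrm{Gal}(\chi)$, $\tau(\chi)$ is the irreducible character $g\mapsto\tau(\chi(g))$; $C(\chi)=\sum_{\tau\in\mathrm{Gal}(\chi)}c_{\tau(\chi)}\in\mathbb{Q}[G]$. Define $LR(\chi)=\{M\in\mathbb{Q}[G] : M=MC(\chi),\ M\cdot\big(\sum_{g\in G}g(\alpha)\,g^{-1}\big)=0\}$, where the product is taken in $\mathbb{C}[G]$. *)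

(* Defs.v *)
(* The complex numbers that occur here are algebraic, so the                  *)
(* field algC of algebraic complex numbers, over which MathComp's characters  *)
(* take their values, plays the role of C.                                    *)
From Stdlib Require Import ClassicalEpsilon.
From HB Require Import structures.
From mathcomp Require Import all_boot all_order all_fingroup all_algebra.
From mathcomp Require Import all_solvable all_field all_character.

Set Implicit Arguments.
Unset Strict Implicit.
Unset Printing Implicit Defensive.

Import Order.TTheory GRing.Theory Num.Theory.
Local Open Scope group_scope.
Local Open Scope ring_scope.

(* The number fields are subfields of a number field N, normal over Q and     *)
(* embedded in C by nu, which need only be large enough to contain alpha and  *)
(* the values of chi.  E stands for Q(alpha) and 'Gal(E / 1) for its Galois   *)
(* group G over Q; every element of the type gal_of E belongs to G.           *)

(* The element of N whose complex value is x (unspecified if x is not in      *)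
(* nu(N)).                                                                    *)
Definition inN (N : splittingFieldType rat) (nu : {rmorphism N -> algC})
  (x : algC) : N := epsilon (inhabits 0) (fun y : N => nu y = x).

(* The underlying space of R[G]; R^o makes it a vector space over R.          *)
Definition galg (R : fieldType) (N : splittingFieldType rat)
  (E : {subfield N}) := {ffun gal_of E -> R^o}.

Definition gelt (R : fieldType) (N : splittingFieldType rat)
  (E : {subfield N}) (g : gal_of E) : galg R E := [ffun h => (h == g)%:R].

(* The composite g o h, x |-> g (h x).  MathComp composes automorphisms from  *)
(* left to right: (x * y)%g a = y (x a), see galM.                            *)
Definition gcomp (N : splittingFieldType rat) (E : {subfield N})
  (g h : gal_of E) : gal_of E := (h * g)%g.

(* The product of the group algebra, for the group law gcomp.  The ring       *)
(* product that MathComp puts on finite functions is the pointwise one.       *)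
Definition galg_mul (R : fieldType) (N : splittingFieldType rat)
  (E : {subfield N}) (A B : galg R E) : galg R E :=
  \sum_(g in 'Gal(E / 1)) \sum_(h in 'Gal(E / 1))
    (A g * B h) *: gelt R (gcomp g h).

Definition galgC (N : splittingFieldType rat) (E : {subfield N})
  (M : galg rat E) : galg algC E := [ffun g => ratr (M g)].

(* c_phi, for an arbitrary function phi in place of an irreducible character. *)
Definition cidem (N : splittingFieldType rat) (E : {subfield N})
  (phi : gal_of E -> algC) : galg algC E :=
  (phi 1%g / #|'Gal(E / 1)|%:R) *:
    \sum_(g in 'Gal(E / 1)) (phi g)^* *: gelt algC g.

Definition Qchar (N : splittingFieldType rat) (nu : {rmorphism N -> algC})
  (E : {subfield N}) (chi : 'CF('Gal(E / 1))) : {subfield N} :=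
  <<1 & [seq inN nu (chi g) | g in 'Gal(E / 1)]>>%AS.

Definition Ccentral (N : splittingFieldType rat) (nu : {rmorphism N -> algC})
  (E : {subfield N}) (chi : 'CF('Gal(E / 1))) : galg algC E :=
  \sum_(tau in 'Gal(Qchar nu chi / 1))
    cidem (fun g => nu (tau (inN nu (chi g)))).

Definition LR (N : splittingFieldType rat) (nu : {rmorphism N -> algC})
  (E : {subfield N}) (alpha : N) (chi : 'CF('Gal(E / 1)))
  (M : galg rat E) : Prop :=
  galgC M = galg_mul (galgC M) (Ccentral nu chi) /\
  galg_mul (galgC M)
    (\sum_(g in 'Gal(E / 1)) nu (g alpha) *: gelt algC (g^-1)%g) = 0.

(* Main.v *)
(* For a linear character psi, M c_psi = psi(M) c_psi. Summing over the       *)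
(* Galois conjugates of chi, one finds that M C(chi) has g-coefficient        *)
(* tr(chi(M) / |G| * chi(g)^-1), so the equation M = M C(chi) says that M is  *)
(* the element T(m) with coefficients tr(m chi(g)^-1) for some m in Q(chi),   *)
(* and orthogonality of the conjugates makes m |-> T(m) injective, with       *)
(* inverse M |-> chi(M) / |G|. The product of T(m) by sum_g g(alpha) g^-1 is  *)
(* a combination of the conjugates tau(chi)^-1, linearly independent as tau   *)
(* varies, with coefficients tau(m) times the resolvents sum_g tau(chi(g))^-1 *)
(* g(alpha): it vanishes iff m = 0 or all the resolvents are 0. By            *)
(* irreducibility of the cyclotomic polynomial these resolvents are the sums  *)
(* over chi^d with d prime to l.                                              *)
Require Import Defs.
From HB Require Import structures.
From mathcomp Require Import all_boot all_order all_fingroup all_algebra.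
From mathcomp Require Import all_solvable all_field all_character.
From mathcomp Require Import ring.

Set Implicit Arguments.
Unset Strict Implicit.
Unset Printing Implicit Defensive.

Import Order.TTheory GRing.Theory Num.Theory.
Local Open Scope group_scope.
Local Open Scope ring_scope.

(** All but the cyclotomic input is proved for any Galois subfield [K] and any multiplicative [c]
    with values in [K] that separate its automorphisms. [mul_galois_idem] and [lin_eval_trace_elt]
    turn M = M C(chi) into membership in the image of [K] under [trace_elt];
    [trace_elt_annihilatesP] treats the second equation. [cyclotomic_gal_exp] and
    [cyclotomic_gal_exists] match the automorphisms of Q(zeta) with the exponents prime to l. *)

Lemma mem_gal1 (N : splittingFieldType rat) (E : {subfield N}) (g : gal_of E) :
  g \in 'Gal(E / 1).
Proof.
(* [galS] reverses inclusions, and every automorphism fixes the fixed field of all of them. *)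
apply: (subsetP (galS E (sub1v (fixedField [set: gal_of E])))).
by rewrite (subsetP (galois_connection_subset _)) ?inE.
Qed.

Lemma sum_gal1 (N : splittingFieldType rat) (E : {subfield N})
    (V : nmodType) (F : gal_of E -> V) :
  \sum_(g in 'Gal(E / 1)) F g = \sum_g F g.
Proof. by apply: eq_bigl => g; rewrite mem_gal1. Qed.

Lemma card_gal1 (N : splittingFieldType rat) (E : {subfield N}) :
  #|'Gal(E / 1)| = #|[set: gal_of E]|.
Proof. by apply: eq_card => g; rewrite mem_gal1 inE. Qed.

(** * Coefficients and convolution in the group algebra *)

Lemma galg_sumE (R : fieldType) (N : splittingFieldType rat) (E : {subfield N})
    (F : gal_of E -> R) (u : gal_of E) :
  (\sum_g F g *: gelt R g : galg R E) u = F u.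
Proof.
rewrite sum_ffunE (bigD1 u) //= !ffunE eqxx big1 => [|g gu].
  by rewrite addr0; apply: mulr1.
by rewrite !ffunE eq_sym (negPf gu); apply: mulr0.
Qed.

(** Since [gcomp g h] is [h * g] in the library's order, it equals [u] exactly when
    [h = u * g^-1]. *)
Lemma galg_mulE (R : fieldType) (N : splittingFieldType rat) (E : {subfield N})
    (A B : galg R E) (u : gal_of E) :
  galg_mul A B u = \sum_g A g * B (u * g^-1)%g.
Proof.
rewrite /galg_mul sum_gal1 sum_ffunE; apply: eq_bigr => g _.
rewrite sum_gal1 (reindex_inj (mulIg g^-1%g)) /=.
rewrite (eq_bigr (fun h => (A g * B (h * g^-1)%g) *: gelt R h)) ?galg_sumE //.
by move=> h _; rewrite /gcomp mulgKV.
Qed.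

Section RationalPart.

Variable N : splittingFieldType rat.

(** A coordinate is linear on all of [N], but it recovers the rational number itself only on the
    line [1%VS]. *)
Definition ratpart (x : N) : rat := coord [tuple (1 : N)] ord0 x.

Lemma ratpart_is_linear : linear (ratpart : N -> rat^o).
Proof. exact: linearP. Qed.

HB.instance Definition _ :=
  GRing.isLinear.Build rat N rat^o *%R ratpart ratpart_is_linear.

Lemma ratpartK (x : N) : x \in 1%VS -> ratr (ratpart x) = x.
Proof.
case/vlineP=> a ->; rewrite linearZ /= /ratpart.
rewrite -[X in coord _ _ X]/([tuple 1 : N]`_(@ord0 0)) coord_free ?eqxx.
  by rewrite mulr1 alg_num_field.
by rewrite seq1_free oner_neq0.
Qed.

End RationalPart.

Lemma galgC_inj (N : splittingFieldType rat) (E : {subfield N}) :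
  injective (@galgC N E).
Proof.
move=> A B /ffunP eqAB; apply/ffunP => g.
by have := eqAB g; rewrite !ffunE => /fmorph_inj.
Qed.

(** * The annihilator attached to a linear character *)

Section LinearCharacter.

Variables (N : splittingFieldType rat) (nu : {rmorphism N -> algC}).
Variables E K : {subfield N}.
Hypothesis galK : galois 1 K.

(* c is chi with its values moved from C into N along nu.                     *)
Variable c : gal_of E -> N.
Hypothesis cM : {morph c : g h / (g * h)%g >-> g * h}.
Hypothesis c1 : c 1%g = 1.
Hypothesis cK : forall g, c g \in K.
Hypothesis c_gen : forall sigma tau : gal_of K,
  (forall g, sigma (c g) = tau (c g)) -> sigma = tau.

Local Notation tr := (galTrace 1 K).
Local Notation n := #|[set: gal_of E]|.

Lemma lin_neq0 g : c g != 0.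
Proof.
have: c g * c g^-1%g = 1 by rewrite -cM mulgV c1.
by apply: contra_eq_neq => ->; rewrite mul0r eq_sym oner_neq0.
Qed.

Lemma linV g : c g^-1%g = (c g)^-1.
Proof. by apply: (mulfI (lin_neq0 g)); rewrite -cM mulgV divff ?lin_neq0. Qed.

Lemma natr_neq0 (F : fieldExtType rat) : n%:R != 0 :> F.
Proof.
by rewrite -(rmorph_nat (in_alg F)) fmorph_eq0 pnatr_eq0 -lt0n cardG_gt0.
Qed.

Lemma galtrE m : tr m = \sum_(tau : gal_of K) tau m.
Proof. exact: sum_gal1. Qed.

Lemma galtrZ a m : tr (a *: m) = a *: tr m.
Proof.
by rewrite !galtrE scaler_sumr; apply: eq_bigr => tau _; rewrite linearZ.
Qed.

(** By [c_gen], distinct automorphisms of [K] give distinct homomorphisms, so this is the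
    orthogonality of linear characters. *)
Lemma lin_orthogonality (sigma tau : gal_of K) :
  \sum_g sigma (c g) * tau (c g)^-1 = (tau == sigma)%:R * n%:R.
Proof.
case: eqVneq => [-> | neq_st].
  under eq_bigr => g _ do rewrite fmorphV divff ?fmorph_eq0 ?lin_neq0 //.
  by rewrite mul1r -sum1_card natr_sum; apply: eq_bigl => g; rewrite inE.
have [g0 neq_g0]: exists g0, sigma (c g0) * tau (c g0)^-1 != 1.
  apply/existsP; apply: contraNT neq_st => /existsPn eq_st.
  apply/eqP/esym/c_gen => g; have := eq_st g; rewrite negbK fmorphV => /eqP eq1.
  by rewrite -[RHS]mul1r -[X in _ = X * _]eq1 mulfVK ?fmorph_eq0 ?lin_neq0.
rewrite mul0r; set S := LHS.
(* Translating the summation by [g0] multiplies the sum by a factor other than 1, so the sum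
   vanishes. *)
have defS: S = sigma (c g0) * tau (c g0)^-1 * S.
  rewrite {1}/S (reindex_inj (mulgI g0)) mulr_sumr; apply: eq_bigr => g _.
  by rewrite /= cM invfM !rmorphM /= mulrACA.
apply/eqP; move/eqP: defS; rewrite -subr_eq0 -[X in X - _]mul1r -mulrBl.
by rewrite mulf_eq0 subr_eq0 eq_sym (negPf neq_g0).
Qed.

(** This is T(m). For m in [K] the trace is rational, so [ratpart] loses nothing. *)
Definition trace_elt (m : N) : galg rat E :=
  [ffun g => ratpart (tr (m * (c g)^-1))].

Lemma trace_elt_is_linear : linear trace_elt.
Proof.
move=> a x y; apply/ffunP => g; rewrite !ffunE mulrDl -scalerAl.
by rewrite raddfD /= galtrZ linearP.
Qed.

HB.instance Definition _ :=
  GRing.isLinear.Build rat N (galg rat E) *:%R trace_elt trace_elt_is_linear.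

Lemma galtr_rat m g : m \in K -> tr (m * (c g)^-1) \in 1%VS.
Proof. by move=> mK; apply: mem_galTrace => //; rewrite rpredM ?rpredV. Qed.

Lemma trace_eltE m g :
  m \in K -> galgC (trace_elt m) g = nu (tr (m * (c g)^-1)).
Proof.
move=> mK; rewrite !ffunE -(fmorph_rat nu) ratpartK //.
exact: galtr_rat.
Qed.

Definition lin_eval (M : galg rat E) : N := \sum_g M g *: c g.

Lemma lin_eval_in M : lin_eval M \in K.
Proof. by apply: rpred_sum => g _; apply: rpredZ. Qed.

(** After expanding the trace, the [tau] term carries the factor of orthogonality between [c] and
    its conjugate by [tau]; only [tau = 1] survives. *)
Lemma lin_eval_trace_elt m : m \in K -> lin_eval (trace_elt m) = n%:R * m.
Proof.
move=> mK; rewrite /lin_eval.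
under eq_bigr => g _ do [rewrite ffunE -mulr_algl alg_num_field ratpartK;
  last exact: galtr_rat].
under eq_bigr => g _ do rewrite galtrE mulr_suml.
rewrite exchange_big /= (bigD1 1%g) //= [X in _ + X]big1 ?addr0 => [|tau tau1].
  have := lin_orthogonality 1%g 1%g; rewrite eqxx mul1r => <-.
  rewrite mulr_suml; apply: eq_bigr => g _.
  by rewrite !gal_id mulrC mulrA mulrAC.
(* Zero is written as [tau m * (0 * n)] to expose the right side of the orthogonality relation. *)
rewrite -[RHS](mulr0 (tau m)) -[in RHS](mul0r n%:R).
have := lin_orthogonality 1%g tau; rewrite (negPf tau1) => <-.
rewrite mulr_sumr; apply: eq_bigr => g _.
by rewrite rmorphM gal_id /= -mulrA; congr (_ * _); apply: mulrC.
Qed.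

(** It has the shape of [Ccentral], so that the two agree once [Qchar nu chi] is rewritten to
    [K]. *)
Definition galois_idem : galg algC E :=
  \sum_(tau in 'Gal(K / 1)) cidem (fun g => nu (tau (c g))).

Hypothesis c_conj : forall (tau : gal_of K) g,
  (nu (tau (c g)))^* = nu (tau (c g)^-1).

Lemma galois_idemE g : galois_idem g = n%:R^-1 * nu (tr (c g)^-1).
Proof.
rewrite /galois_idem sum_gal1 sum_ffunE galtrE rmorph_sum mulr_sumr.
apply: eq_bigr => tau _; rewrite /cidem sum_gal1 card_gal1 c1 !rmorph1 mul1r.
by rewrite ffunE galg_sumE -c_conj.
Qed.

(** The value [c (u * g^-1)^-1] splits as [c g * (c u)^-1], and the rational scalars [M g] and
    [n^-1] move inside the trace. *)
Lemma mul_galois_idem M :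
  galg_mul (galgC M) galois_idem = galgC (trace_elt (n%:R^-1 * lin_eval M)).
Proof.
apply/ffunP => u; rewrite galg_mulE trace_eltE; last first.
  by rewrite rpredM ?lin_eval_in // rpredV rpred_nat.
rewrite -mulrA mulr_suml mulr_sumr (raddf_sum tr) /= rmorph_sum.
apply: eq_bigr => g _; rewrite galois_idemE ffunE cM linV invfM invrK.
rewrite -[in RHS]scalerAl -[in RHS]scalerAr galtrZ rmorphZ_num.
have ->: n%:R^-1 = (n%:R^-1)%:A :> N by rewrite -in_algE fmorphV rmorph_nat.
rewrite mulr_algl galtrZ rmorphZ_num fmorphV rmorph_nat.
by rewrite [X in tr X]mulrC.
Qed.

Variable alpha : N.

(** The Lagrange resolvent of [alpha] for the inverse of the conjugate of [c] by [tau]. *)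
Definition resolvent (tau : gal_of K) : algC :=
  \sum_g nu (tau (c g)^-1) * nu (g alpha).

Definition galois_elt : galg algC E :=
  \sum_(g in 'Gal(E / 1)) nu (g alpha) *: gelt algC (g^-1)%g.

Lemma galois_eltE g : galois_elt g = nu ((g^-1)%g alpha).
Proof.
rewrite /galois_elt sum_gal1 (reindex_inj invg_inj) /=.
rewrite (eq_bigr (fun h : gal_of E => nu ((h^-1)%g alpha) *: gelt algC h)).
  exact: galg_sumE.
by move=> h _; rewrite invgK.
Qed.

(** Replacing the summation variable by [h * u] separates [c u] from [h]; the sum over [h] is then a
    resolvent. *)
Lemma mul_trace_elt_galois_elt m u : m \in K ->
  galg_mul (galgC (trace_elt m)) galois_elt u =
  \sum_(tau : gal_of K) nu (tau m * tau (c u)^-1) * resolvent tau.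
Proof.
move=> mK; rewrite galg_mulE (reindex_inj (mulIg u)) /=.
under eq_bigr => h _ do
  rewrite trace_eltE // galois_eltE galtrE rmorph_sum mulr_suml.
rewrite exchange_big /=; apply: eq_bigr => tau _.
rewrite mulr_sumr; apply: eq_bigr => h _.
rewrite invMg invgK mulgK cM invfM !rmorphM /=.
by rewrite !mulrA; congr (_ * _); rewrite mulrAC.
Qed.

Lemma trace_elt_annihilatesP m : m \in K ->
  galg_mul (galgC (trace_elt m)) galois_elt = 0 <->
  m = 0 \/ forall tau, resolvent tau = 0.
Proof.
move=> mK; split=> [mul0 | [-> | res0]]; last first.
- apply/ffunP => u; rewrite mul_trace_elt_galois_elt // big1 ?ffunE // => tau _.
  by rewrite res0 mulr0.
- apply/ffunP => u; rewrite mul_trace_elt_galois_elt ?rpred0 // big1 ?ffunE //.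
  by move=> tau _; rewrite rmorph0 mul0r rmorph0 mul0r.
have [-> | m_neq0] := eqVneq m 0; [by left | right=> sigma].
(* Pairing the product with the conjugate of [c] by [sigma] isolates, by orthogonality, n times
   [nu (sigma m) * resolvent sigma]. *)
have: \sum_u nu (sigma (c u)) * galg_mul (galgC (trace_elt m)) galois_elt u = 0.
  by rewrite big1 // => u _; rewrite mul0 ffunE mulr0.
under eq_bigr => u _ do rewrite mul_trace_elt_galois_elt // mulr_sumr.
rewrite exchange_big /= (bigD1 sigma) //= [X in _ + X]big1 ?addr0.
  rewrite (eq_bigr (fun u => nu (sigma m) * resolvent sigma *
      nu (sigma (c u) * sigma (c u)^-1))) => [|u _]; last first.
    by rewrite !rmorphM /=; ring.
  rewrite -mulr_sumr -rmorph_sum lin_orthogonality eqxx mul1r rmorph_nat.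
  move/eqP; rewrite !mulf_eq0 pnatr_eq0 -[_ == 0%N]negbK -lt0n cardG_gt0 orbF.
  by rewrite !fmorph_eq0 (negPf m_neq0) => /eqP.
move=> tau tau_s.
rewrite (eq_bigr (fun u => nu (tau m) * resolvent tau *
    nu (sigma (c u) * tau (c u)^-1))) => [|u _]; last first.
  by rewrite !rmorphM /=; ring.
rewrite -mulr_sumr -rmorph_sum lin_orthogonality (negPf tau_s) mul0r.
by rewrite rmorph0 mulr0.
Qed.

Definition annihilates_alpha (M : galg rat E) : Prop :=
  galgC M = galg_mul (galgC M) galois_idem /\
  galg_mul (galgC M) galois_elt = 0.

Lemma annihilates_alphaP M :
  annihilates_alpha M <->
  exists2 m, m \in K &
    M = trace_elt m /\ (m = 0 \/ forall tau, resolvent tau = 0).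
Proof.
rewrite /annihilates_alpha mul_galois_idem; split=> [[/galgC_inj defM mul0] | ].
  have mK: n%:R^-1 * lin_eval M \in K.
    by rewrite rpredM ?lin_eval_in // rpredV rpred_nat.
  exists (n%:R^-1 * lin_eval M) => //; split=> //.
  by apply/(trace_elt_annihilatesP mK); rewrite -defM.
case=> m mK [-> /(trace_elt_annihilatesP mK)-> ]; split=> //.
by rewrite lin_eval_trace_elt // mulKf ?natr_neq0.
Qed.

Lemma trace_elt_inj : {in K &, injective trace_elt}.
Proof.
move=> x y xK yK eqT; apply: (mulfI (natr_neq0 N)).
by rewrite -!lin_eval_trace_elt ?eqT.
Qed.

Lemma annihilates_alpha_neq0P :
  (exists2 M, annihilates_alpha M & M != 0) <->
  forall tau, resolvent tau = 0.
Proof.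
split=> [[M /annihilates_alphaP[m mK [-> [-> | //]]]] | res0].
  by rewrite raddf0 eqxx.
(* T(1) is n times the idempotent; it is nonzero because T is injective on [K]. *)
exists (trace_elt 1).
  by apply/annihilates_alphaP; exists 1; rewrite ?rpred1 //; split; [|right].
rewrite -(raddf0 trace_elt); apply: contra_neq (oner_neq0 N) => /trace_elt_inj.
by apply; rewrite ?rpred0 ?rpred1.
Qed.

Lemma annihilates_alpha_eq0_or :
  (forall M, annihilates_alpha M <-> M = 0) \/ (forall tau, resolvent tau = 0).
Proof.
have [/forallP res0 | /forallPn nres0] :=
  boolP [forall tau, resolvent tau == 0].
  by right=> tau; apply/eqP/res0.
left=> M; split=> [/annihilates_alphaP[m mK [-> [-> | res0]]] | ->].
- exact: raddf0.
- by case: nres0 => tau; rewrite res0 eqxx.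
apply/annihilates_alphaP; exists 0; first exact: rpred0.
by rewrite raddf0; split; [|left].
Qed.

Hypothesis resolvent0 : forall tau, resolvent tau = 0.

Lemma annihilates_alpha_traceP M :
  annihilates_alpha M <-> exists2 m, m \in K & M = trace_elt m.
Proof.
rewrite annihilates_alphaP; split=> [[m mK [-> _]] | [m mK ->]]; exists m => //.
by split; [|right].
Qed.

Lemma dim_annihilates_alpha :
  exists2 V : {vspace galg rat E},
    (forall M, M \in V <-> annihilates_alpha M) & \dim V = \dim K.
Proof.
exists (linfun trace_elt @: K)%VS => [M|].
  rewrite annihilates_alpha_traceP; split=> [/memv_imgP[m mK ->] | [m mK ->]].
    by exists m; rewrite ?lfunE.
  by rewrite -[trace_elt m]lfunE memv_img.
apply: limg_dim_eq; apply/eqP; rewrite -subv0; apply/subvP => m.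
case/memv_capP => mK; rewrite memv_ker lfunE /= -(raddf0 trace_elt) => /eqP.
by move/trace_elt_inj => ->; rewrite ?rpred0 ?mem0v.
Qed.

End LinearCharacter.

(** * Automorphisms of the cyclotomic field *)

Section CyclotomicSubfield.

Variables (N : splittingFieldType rat) (l : nat) (zeta : N).
Hypothesis zeta_prim : l.-primitive_root zeta.

Lemma galois_cyclotomic : galois 1 <<1; zeta>>.
Proof.
apply/splitting_galoisField; exists ('X^l - 1); split.
- by rewrite rpredB ?rpredX ?polyOverX ?rpred1.
- by apply: separable_Xn_sub_1; apply: prim_root_natf_neq0 zeta_prim.
exists [seq zeta ^+ i | i <- index_iota 0 l].
  by rewrite big_map factor_Xn_sub_1 ?eqpxx.
apply/eqP; rewrite eqEsubv; apply/andP; split.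
  apply/Fadjoin_seqP; split=> [|_ /mapP[i _ ->]]; first exact: subv_adjoin.
  by rewrite rpredX ?memv_adjoin.
apply/FadjoinP; split; first exact: subv_adjoin_seq.
(* For l = 1 the list of roots holds only [zeta ^+ 0], so [zeta] is not found at index 1. *)
have [l1 | l_gt1] := leqP l 1.
  have l_eq1: l = 1%N.
    by apply/eqP; rewrite eqn_leq l1 (prim_order_gt0 zeta_prim).
  have zeta1 : zeta = 1 by have := prim_expr_order zeta_prim; rewrite l_eq1.
  by rewrite zeta1 rpred1.
apply: seqv_sub_adjoin; apply/mapP; exists 1%N; rewrite ?expr1 //.
by rewrite mem_index_iota.
Qed.

Lemma cyclotomic_gal_exp (tau : gal_of <<1; zeta>>) :
  exists2 k, coprime k l & tau zeta = zeta ^+ k.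
Proof.
have tau_prim: l.-primitive_root (tau zeta) by rewrite fmorph_primitive_root.
have [k defk] := prim_rootP zeta_prim (prim_expr_order tau_prim).
by exists k => //; rewrite -(prim_root_exp_coprime k zeta_prim) -defk.
Qed.

(** Irreducibility of the cyclotomic polynomial enters through [Qn_aut_exists]. Its [u] acts on
    [algC], so it only serves to show that [zeta ^+ k] is a root of the minimal polynomial of
    [zeta]; normality then gives [tau]. *)
Lemma cyclotomic_gal_exists (nu : {rmorphism N -> algC}) k :
  coprime k l -> exists tau : gal_of <<1; zeta>>, tau zeta = zeta ^+ k.
Proof.
move=> co_k_l; have [u u_exp] := Qn_aut_exists co_k_l.
have /and3P[sub1 _ normK] := galois_cyclotomic.
have zroot: root (minPoly 1 zeta) (zeta ^+ k).
  have /polyOver1P[p defp] := minPolyOver 1 zeta.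
  have alg_nu (x : rat) : u (nu x%:A) = nu x%:A.
    by rewrite alg_num_field !fmorph_rat.
  rewrite -(fmorph_root nu) rmorphXn /= -u_exp; last first.
    by rewrite -rmorphXn (prim_expr_order zeta_prim) rmorph1.
  have ->: map_poly nu (minPoly 1 zeta) =
           map_poly u (map_poly nu (minPoly 1 zeta)).
    rewrite defp -!map_poly_comp; apply: eq_map_poly => x /=.
    exact/esym/alg_nu.
  by rewrite !fmorph_root root_minPoly.
have [tau _ tau_zeta] :=
  normalField_root_minPoly sub1 normK (memv_adjoin _ _) zroot.
by exists tau.
Qed.

End CyclotomicSubfield.

(** The order of [xi] is the exponent of the abelian group [G / cfker xi], which some coset attains;
    [xi] is faithful on that quotient. *)
Lemma lin_char_prim_value (gT : finGroupType) (G : {group gT}) (xi : 'CF(G)) :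
  xi \is a linear_char ->
  exists2 g, g \in G & #[xi]%CF.-primitive_root (xi g).
Proof.
move=> xi_lin; rewrite cforder_lin_char //.
have abG : abelian (G / cfker xi) by rewrite sub_der1_abelian ?lin_char_der1.
have [_ /morphimP[g gN gG ->] ->] := exponent_witness (abelian_nil abG).
exists g => //; rewrite /=.
have xi_g k : (xi g ^+ k == 1) = (#[coset (cfker xi) g]%g %| k)%N.
  rewrite order_dvdn -morphX // -lin_charX //.
  apply/idP/eqP => [/eqP xi1 | /coset_idr ker_g].
    apply: coset_id; rewrite cfkerEchar ?lin_charW // inE groupX //.
    by rewrite xi1 lin_char1 /=.
  by rewrite cfker1 ?lin_char1 // ker_g ?groupX.
apply/andP; split; first exact: order_gt0.
apply/forallP => i; rewrite unity_rootE xi_g; apply/eqP.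
apply/idP/eqP => [/dvdn_leq-/(_ isT) le_i | -> //].
by apply/eqP; rewrite eqn_leq ltn_ord.
Qed.

(** * Specialization to [chi] and Q(zeta) *)

Theorem theorem1
  (N : splittingFieldType rat) (nu : {rmorphism N -> algC})
  (f : {poly int}) (alpha : N) (E : {subfield N})
  (f_monic : f \is monic)
  (f_irr : irreducible_poly (map_poly intr f : {poly rat}))
  (f_alpha : root (map_poly intr f) (nu alpha))
  (E_def : E = <<1; alpha>>%AS)
  (E_galois : galois 1 E)
  (chi : 'CF('Gal(E / 1)))
  (chi_irr : chi \in irr 'Gal(E / 1))
  (chi_deg1 : chi 1%g = 1)
  (l : nat) (l_order : l = #[chi]%CF)
  (zeta : N) (zeta_prim : l.-primitive_root zeta) :
  [/\ Qchar nu chi = <<1; zeta>>%AS,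
      (forall M : galg rat E, LR nu alpha chi M <-> M = 0) \/
      (forall d : int, coprimez d l ->
         \sum_(g in 'Gal(E / 1)) chi g ^ d * nu (g alpha) = 0),
      (exists2 M : galg rat E, LR nu alpha chi M & M != 0) <->
      (forall d : int, coprimez d l ->
         \sum_(g in 'Gal(E / 1)) chi g ^ d * nu (g alpha) = 0)
    & (exists2 M : galg rat E, LR nu alpha chi M & M != 0) ->
      (forall M : galg rat E,
         LR nu alpha chi M <->
         exists2 m : N, m \in <<1; zeta>>%AS &
           galgC M = \sum_(g in 'Gal(E / 1))
             nu (galTrace 1 <<1; zeta>> (m * inN nu (chi g)^*)) *:
               gelt algC g) /\
      (exists2 V : {vspace galg rat E},
         (forall M : galg rat E, M \in V <-> LR nu alpha chi M) &
         \dim V = \dim <<1; zeta>>) ].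
Proof.
have chi_lin: chi \is a linear_char.
  rewrite qualifE /= chi_deg1 eqxx andbT.
  by have /irrP[i ->] := chi_irr; apply: irr_char.
have memG (g : gal_of E) : g \in 'Gal(E / 1)%G by apply: mem_gal1.
have chi_l g : chi g ^+ l = 1.
  by rewrite l_order; apply/(dvdn_cforderP _ _); rewrite ?dvdnn.
have l_gt0 := prim_order_gt0 zeta_prim.
pose K := <<1; zeta>>%AS; pose c g := inN nu (chi g).
(* The values of [chi] are l-th roots of unity, hence powers of [nu zeta], so [inN] does return a
   preimage. *)
have cP g : exists i : 'I_l, c g = zeta ^+ i /\ nu (c g) = chi g.
  have nu_prim: l.-primitive_root (nu zeta) by rewrite fmorph_primitive_root.
  have [i chi_i] := prim_rootP nu_prim (chi_l g); exists i.
  have nu_c : nu (c g) = chi g.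
    apply: (ClassicalEpsilon.epsilon_spec (inhabits 0) (fun y => nu y = chi g)).
    by exists (zeta ^+ i); rewrite rmorphXn.
  by split=> //; apply: (fmorph_inj nu); rewrite nu_c chi_i rmorphXn.
have nu_c g : nu (c g) = chi g by have [i []] := cP g.
have cM : {morph c : g h / (g * h)%g >-> g * h}.
  by move=> g h; apply: (fmorph_inj nu); rewrite rmorphM /= !nu_c lin_charM.
have c1 : c 1%g = 1 by apply: (fmorph_inj nu); rewrite nu_c rmorph1.
have cK g : c g \in K.
  by have [i [-> _]] := cP g; rewrite rpredX ?memv_adjoin.
have [g0 _ chi_g0] := lin_char_prim_value chi_lin.
have c_g0 : l.-primitive_root (c g0).
  by rewrite -(fmorph_primitive_root nu) nu_c l_order.
(* [zeta] is a power of one value of [c], which gives the inclusion of Q(zeta) in Q(chi). *)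
have [j zeta_j] := prim_rootP c_g0 (prim_expr_order zeta_prim).
have defK : Qchar nu chi = K.
  apply/val_inj/eqP; rewrite eqEsubv; apply/andP; split.
    apply/Fadjoin_seqP; split=> [|_ /imageP[g _ ->]]; last exact: cK.
    exact: subv_adjoin.
  apply/FadjoinP; split; first exact: subv_adjoin_seq.
  rewrite zeta_j rpredX //; apply: seqv_sub_adjoin; apply/imageP.
  by exists g0; rewrite ?memG.
have c_gen (sigma tau : gal_of K) :
    (forall g, sigma (c g) = tau (c g)) -> sigma = tau.
  move=> eq_st; apply/eqP; rewrite gal_adjoin_eq ?mem_gal1 //.
  have eq_pow x : x = c g0 ^+ j -> sigma x = tau x.
    by move=> ->; rewrite !rmorphXn /= eq_st.
  exact/eqP/eq_pow.
have tau_c (tau : gal_of K) k g : tau zeta = zeta ^+ k -> tau (c g) = c g ^+ k.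
  by move=> tau_z; have [i [-> _]] := cP g; rewrite rmorphXn /= tau_z exprAC.
have c_conj (tau : gal_of K) g : (nu (tau (c g)))^* = nu (tau (c g)^-1).
  have [k _ /tau_c tau_k] := cyclotomic_gal_exp zeta_prim tau.
  have ->: nu (tau (c g)^-1) = (chi g ^+ k)^-1.
    by rewrite !fmorphV /= tau_k rmorphXn /= nu_c.
  rewrite tau_k rmorphXn /= nu_c invC_norm normrX normC_lin_char //.
  by rewrite !expr1n invr1 mul1r.
have galK := galois_cyclotomic zeta_prim.
have LR_E M : LR nu alpha chi M <-> annihilates_alpha nu K c alpha M.
  by rewrite /LR /Ccentral defK.
have res0P : (forall tau, resolvent nu (K := K) c alpha tau = 0) <->
    forall d : int, coprimez d l ->
      \sum_(g in 'Gal(E / 1)) chi g ^ d * nu (g alpha) = 0.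
  have resE (tau : gal_of K) (k : nat) : tau zeta = zeta ^+ k ->
      resolvent nu c alpha tau =
      \sum_(g in 'Gal(E / 1)) chi g ^ (- k%:Z) * nu (g alpha).
    move=> /tau_c tau_k; rewrite sum_gal1; apply: eq_bigr => g _.
    by rewrite !fmorphV /= tau_k rmorphXn /= nu_c exprnN.
  split=> [res0 d co_d_l | sum0 tau].
    have l_neq0 : l%:Z != 0 by rewrite eqz_nat -lt0n.
    (* The resolvent of [tau] has exponent -k when [tau zeta = zeta ^+ k]. So k is the residue of
       -d, and the multiple of l that separates d from -k is harmless as [chi g ^+ l = 1]. *)
    have [k defk] : exists k : nat, (- d %% l)%Z = k.
      by exists `|(- d %% l)%Z|%N; rewrite gez0_abs ?modz_ge0.
    have co_k_l : coprime k l.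
      rewrite -[coprime k l]/(coprimez k l) -defk /coprimez gcdz_modl.
      by rewrite -/(coprimez _ _) coprimeNz.
    have [tau tau_z] := cyclotomic_gal_exists zeta_prim nu co_k_l.
    rewrite -[RHS](res0 tau) (resE _ _ tau_z).
    apply: eq_bigr => g _; congr (_ * _).
    have chi_neq0 : chi g != 0 by rewrite lin_char_neq0.
    rewrite -[in LHS](opprK d) (divz_eq (- d) l) defk opprD expfzDr //.
    by rewrite -mulNr [- _ * _]mulrC -exprz_exp -exprnP chi_l exp1rz mul1r.
  have [k co_k_l tau_z] := cyclotomic_gal_exp zeta_prim tau.
  by rewrite (resE _ _ tau_z) sum0 // coprimeNz coprimezE.
split=> //.
- have [LR0 | res0] :=
    annihilates_alpha_eq0_or galK cM c1 cK c_gen c_conj alpha.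
    by left=> M; rewrite LR_E; apply: LR0.
  by right; apply/res0P.
- rewrite -res0P -(annihilates_alpha_neq0P galK cM c1 cK c_gen c_conj alpha).
  by split=> [] [M /LR_E]; exists M.
case=> M0 /LR_E LR_M0 M0_neq0.
have res0 : forall tau, resolvent nu (K := K) c alpha tau = 0.
  apply/(annihilates_alpha_neq0P galK cM c1 cK c_gen c_conj alpha).
  by exists M0.
split=> [M|].
  rewrite LR_E (annihilates_alpha_traceP galK cM c1 cK c_gen c_conj res0).
  have trE m : m \in K -> galgC (trace_elt K c m) =
      \sum_(g in 'Gal(E / 1))
         nu (galTrace 1 K (m * inN nu (chi g)^*)) *: gelt algC g.
    move=> mK; apply/ffunP => g; rewrite sum_gal1 galg_sumE (trace_eltE nu) //.
    (* The conjugate of [chi g] is [chi g^-1], so its preimage in [N] is [c g^-1], the inverse of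
       [c g]. *)
    by rewrite -lin_charV_conj // -linV.
  split=> [] [m mK defM]; exists m => //; first by rewrite defM trE.
  by apply: galgC_inj; rewrite defM trE.
have [V memV dimV] :=
  dim_annihilates_alpha galK cM c1 cK c_gen c_conj res0.
by exists V => // M; rewrite memV LR_E.
Qed.
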